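(* Let $u(x,t)$ be a sufficiently smooth real-valued solution of the generalized sine-Gordon equation $u_{tx}=(1-\partial_x^2)\sin(u)$, $x\in\mathbb{R}$, $t>0$, such that $\cos(u(x,t))-1$ has sufficient decay as $x\to\pm\infty$. Set $m=1+u_x^2$ and let $Q(y,\tau)$ be the corresponding solution of the sine-Gordon equation $Q_{\tau y}=\sin(Q)$ given by $$Q(y,\tau)=-u(x,t)-\arcsin\left(\frac{u_x(x,t)}{\sqrt{1+u_x^2(x,t)}}\right),\qquad y=x-t+\int_{-\infty}^x\left(\sqrt{1+u_x^2(x',t)}-1\right)dx',\quad \tau=t.$$ Suppose that the sine-Gordon equation admits a conservation law $A_\tau=B_y$, where $A$ and $B$ are functionals of $Q(y,\tau)$ and its $y$-derivatives. Then, under the change of variables $(x,t)\mapsto(y,\tau)$, one obtains the following conservation law for the generalized sine-Gordon equation: $$\left(\sqrt m\,A\right)_t=\left(B-\cos(u)\sqrt m\,A\right)_x,$$ where $A$ and $B$ are expressed as functions of $(x,t)$ through $u$ by the formulas above.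
   Context: Subscripts denote partial derivatives. ''Sufficient smoothness and decay'' means that $u$ is regular enough for all derivatives used to exist and be continuous, that $u(x,t)\to2\pi n$ for some $n\in\mathbb{Z}$ and $u_x(x,t)\to0$ as $x\to-\infty$, and that the integral defining $y$ converges and may be differentiated in $x$ and $t$ (the $t$-derivative being taken under the integral sign). Since $y_x=\sqrt m\ge1$, $(x,t)\mapsto(y,\tau)$ is an invertible change of variables. *)

(* Defs.v *)
From Stdlib Require Import Reals List.
From Coquelicot Require Import Coquelicot.
Open Scope R_scope.

(* Fields f : R -> R -> R take the space variable (x or y) first and the time
   variable (t or tau) second.  Time ranges over the positive reals: only the
   values f x t with 0 < t matter. *)

Definition Dx (f : R -> R -> R) (x t : R) : R := Derive (fun x' => f x' t) x.
Definition Dt (f : R -> R -> R) (x t : R) : R := Derive (fun t' => f x t') t.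

Definition Dxn (j : nat) (f : R -> R -> R) (x t : R) : R :=
  Derive_n (fun x' => f x' t) j x.

Definition has_Dx (f : R -> R -> R) : Prop :=
  forall x t, 0 < t -> ex_derive (fun x' => f x' t) x.
Definition has_Dt (f : R -> R -> R) : Prop :=
  forall x t, 0 < t -> ex_derive (fun t' => f x t') t.
Definition has_Dxn (j : nat) (f : R -> R -> R) : Prop :=
  forall x t, 0 < t -> ex_derive_n (fun x' => f x' t) j x.

Definition jointly_continuous (f : R -> R -> R) : Prop :=
  forall x t, 0 < t -> continuity_2d_pt f x t.

Definition conserved (rho J : R -> R -> R) : Prop :=
  has_Dt rho /\ has_Dx J /\ forall x t, 0 < t -> Dt rho x t = Dx J x t.

(* The order k is the highest order of the y-derivatives of Q entering the
   conservation law under consideration; first derivatives of a function of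
   Q, ..., d_y^k Q then involve y-derivatives of Q up to order k + 1. *)
Record SG_solution (k : nat) (Q : R -> R -> R) : Prop := {
  SG_y_derivatives : forall j, (j <= S k)%nat ->
    has_Dxn j Q /\ jointly_continuous (Dxn j Q);
  SG_tau_derivative : has_Dt Q /\ jointly_continuous (Dt Q);
  SG_mixed_derivative : has_Dx (Dt Q);
  SG_equation : forall y tau, 0 < tau -> Dx (Dt Q) y tau = sin (Q y tau)
}.

(* [A (q_0 :: ... :: q_k :: nil) y] is the value at y of the functional A when
   q_j is the profile y |-> d_y^j Q(y, tau).  A local functional
   a(Q, Q_y, ..., d_y^k Q) only uses the numbers q_0 y, ..., q_k y. *)
Definition functional : Type := list (R -> R) -> R -> R.

Definition eval_functional (k : nat) (A : functional) (Q : R -> R -> R)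
    (y tau : R) : R :=
  A (map (fun j => fun y' => Dxn j Q y' tau) (seq 0 (S k))) y.

(* A_tau = B_y holds along every solution.  The regularity clauses are
   automatic when A and B are C^1 functions of Q, ..., d_y^k Q. *)
Definition SG_conservation_law (k : nat) (A B : functional) : Prop :=
  forall Q, SG_solution k Q ->
    let AQ := eval_functional k A Q in
    let BQ := eval_functional k B Q in
    (has_Dt AQ /\ jointly_continuous (Dt AQ)) /\
    (has_Dx AQ /\ jointly_continuous (Dx AQ)) /\
    conserved AQ BQ.

Definition m (u : R -> R -> R) (x t : R) : R := 1 + Dx u x t ^ 2.

Definition sqrt_m (u : R -> R -> R) (x t : R) : R := sqrt (m u x t).

Definition y_integral (u : R -> R -> R) (x t : R) : R :=
  RInt_gen (fun x' => sqrt_m u x' t - 1) (Rbar_locally m_infty) (at_point x).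

Definition y_of (u : R -> R -> R) (x t : R) : R := x - t + y_integral u x t.

(* The x-derivatives of order at most k + 2 are those entering the equation and
   the y-derivatives of order at most k + 1 of Q, which contains u_x. *)
Record smooth (k : nat) (u : R -> R -> R) : Prop := {
  smooth_x : forall j, (j <= k + 2)%nat ->
    has_Dxn j u /\ jointly_continuous (Dxn j u);
  smooth_t : has_Dt u /\ jointly_continuous (Dt u);
  smooth_tx : has_Dx (Dt u) /\ jointly_continuous (Dx (Dt u));
  smooth_xt : has_Dt (Dx u) /\ jointly_continuous (Dt (Dx u))
}.

Record decaying (u : R -> R -> R) : Prop := {
  decay_u : forall t, 0 < t ->
    exists n : Z, is_lim (fun x => u x t) m_infty (2 * PI * IZR n);
  decay_ux : forall t, 0 < t -> is_lim (fun x => Dx u x t) m_infty 0;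
  y_integral_converges : forall x t, 0 < t ->
    ex_RInt_gen (fun x' => sqrt_m u x' t - 1)
      (Rbar_locally m_infty) (at_point x);
  y_integral_dx : has_Dx (y_integral u);
  y_integral_dt : forall x t, 0 < t ->
    exists l : R,
      is_RInt_gen (fun x' => Dt (sqrt_m u) x' t)
        (Rbar_locally m_infty) (at_point x) l /\
      is_derive (fun t' => y_integral u x t') t l
}.

Definition gSG_equation (u : R -> R -> R) : Prop :=
  forall x t, 0 < t ->
    Dx (Dt u) x t = sin (u x t) - Dxn 2 (fun x' t' => sin (u x' t')) x t.

(* As (x, t) |-> (y, t) is a bijection of R x (0, +oo), this determines
   Q y tau for all y and all tau > 0. *)
Definition corresponding (u Q : R -> R -> R) : Prop :=
  forall x t, 0 < t ->
    Q (y_of u x t) t = - u x t - asin (Dx u x t / sqrt (1 + Dx u x t ^ 2)).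

Definition in_xt (u f : R -> R -> R) (x t : R) : R := f (y_of u x t) t.

(* Main.v *)
(** A function of (x, t) pulled back along y satisfies f_x = y_x f_y and
    f_t = f_tau + y_t f_y.  Here y_x = sqrt m, and the equation for u is
    equivalent to (sqrt m)_t = - (cos u sqrt m)_x; integrating this from
    -infinity, where cos u sqrt m tends to 1, gives y_t = - cos u sqrt m.
    The two sides of the new conservation law then differ by
    sqrt m (A_tau - B_y).

    That Q solves the sine-Gordon equation with the required regularity comes
    from Q(y, tau) = q(x(y, tau), tau) with q = - u - atan u_x, where the
    inverse change of variables satisfies x_y = 1 / sqrt m and x_tau = cos u:
    every y-derivative of Q is an iterate of f |-> f_x / sqrt m on q, and
    Q_tau simplifies to - u_t - sin u - cos u u_x, with no second derivatives. *)

From Stdlib Require Import Reals List ZArith Lra Lia ClassicalEpsilon.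
From Coquelicot Require Import Coquelicot.
Require Import Defs.
Open Scope R_scope.

(** * Fields at positive times: joint continuity and the chain rule *)

Lemma locally_2d_time_pos (x t : R) : 0 < t -> locally_2d (fun _ s => 0 < s) x t.
Proof.
  intros ht; exists (mkposreal t ht); simpl; intros a s _ hs.
  apply Rabs_def2 in hs; lra.
Qed.

Lemma locally_time_pos (t : R) : 0 < t -> locally t (fun s => 0 < s).
Proof. intros ht; exact (open_gt 0 t ht). Qed.

Lemma has_Dx_is_derive (f : R -> R -> R) (x t : R) :
  has_Dx f -> 0 < t -> is_derive (fun x' => f x' t) x (Dx f x t).
Proof. intros hf ht; apply Derive_correct, hf, ht. Qed.

Lemma has_Dt_is_derive (f : R -> R -> R) (x t : R) :
  has_Dt f -> 0 < t -> is_derive (fun t' => f x t') t (Dt f x t).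
Proof. intros hf ht; apply Derive_correct, hf, ht. Qed.

(** Positive times form an open set, so agreement there is agreement near each relevant point. *)
Lemma jointly_continuous_ext (f g : R -> R -> R) :
  (forall x t, 0 < t -> f x t = g x t) ->
  jointly_continuous f -> jointly_continuous g.
Proof.
  intros h hf x t ht.
  apply continuity_2d_pt_ext_loc with f; [|now apply hf].
  destruct (locally_2d_time_pos x t ht) as [d hd].
  exists d; intros a s ha hs; apply h, (hd a s ha hs).
Qed.

Lemma jointly_continuous_continuous (f : R -> R -> R) (x t : R) :
  jointly_continuous f -> 0 < t ->
  continuous (fun z : R * R => f (fst z) (snd z)) (x, t).
Proof. intros hf ht; now apply continuity_2d_pt_filterlim, hf. Qed.

Lemma jointly_continuous_slice (f : R -> R -> R) (x t : R) :
  jointly_continuous f -> 0 < t -> continuous (fun x' => f x' t) x.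
Proof.
  intros hf ht.
  apply (continuous_comp_2 (fun x' : R => x') (fun _ => t) f).
  - apply continuous_id.
  - apply continuous_const.
  - now apply jointly_continuous_continuous.
Qed.

Lemma jointly_continuous_comp (phi : R -> R) (f : R -> R -> R) :
  (forall z, ex_derive phi z) -> jointly_continuous f ->
  jointly_continuous (fun x t => phi (f x t)).
Proof.
  intros hphi hf x t ht; apply continuity_1d_2d_pt_comp; [|now apply hf].
  apply continuity_pt_filterlim.
  exact (ex_derive_continuous (V := R_NormedModule) phi (f x t) (hphi _)).
Qed.

Lemma jointly_continuous_plus (f g : R -> R -> R) :
  jointly_continuous f -> jointly_continuous g ->
  jointly_continuous (fun x t => f x t + g x t).
Proof. intros hf hg x t ht; apply continuity_2d_pt_plus; [now apply hf|now apply hg]. Qed.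

Lemma jointly_continuous_mult (f g : R -> R -> R) :
  jointly_continuous f -> jointly_continuous g ->
  jointly_continuous (fun x t => f x t * g x t).
Proof. intros hf hg x t ht; apply continuity_2d_pt_mult; [now apply hf|now apply hg]. Qed.

Lemma jointly_continuous_opp (f : R -> R -> R) :
  jointly_continuous f -> jointly_continuous (fun x t => - f x t).
Proof. intros hf x t ht; apply continuity_2d_pt_opp; now apply hf. Qed.

(** Total differentiability needs continuity of only one of the two partial derivatives. The lemma
    is used along both changes of variables: with [xi] the curve [y_of u x], and with [xi] the curve
    [x_of u y]. *)
Lemma is_derive_along_graph (f : R -> R -> R) (xi : R -> R) (dxi t : R) :
  0 < t -> has_Dx f -> jointly_continuous (Dx f) -> has_Dt f ->
  is_derive xi t dxi ->
  is_derive (fun s => f (xi s) s) t (Dx f (xi t) t * dxi + Dt f (xi t) t).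
Proof.
  intros ht hx hcx hft hxi.
  assert (hd : differentiable_pt_lim f (xi t) t (Dx f (xi t) t) (Dt f (xi t) t)).
  { apply filterdiff_differentiable_pt_lim.
    apply (is_derive_filterdiff f (xi t) t (Dx f) (Dt f (xi t) t)).
    - apply (locally_2d_locally (fun a s => is_derive (fun z => f z s) a (Dx f a s))).
      destruct (locally_2d_time_pos (xi t) t ht) as [d h].
      exists d; intros a s ha hs; apply has_Dx_is_derive; [easy|exact (h a s ha hs)].
    - now apply has_Dt_is_derive.
    - now apply jointly_continuous_continuous. }
  apply is_derive_Reals.
  (* The factor 1 is the derivative of the second component s of the curve. *)
  replace (Dt f (xi t) t) with (Dt f (xi t) t * 1) by ring.
  apply (derivable_pt_lim_comp_2d f xi (fun s => s)).
  - exact hd.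
  - now apply is_derive_Reals.
  - apply derivable_pt_lim_id.
Qed.

(** * Functions with continuous x-derivatives *)

(** The recursion passes to [Dx f] itself. Closure under an operation then needs only the formula
    for a first derivative and an induction over all fields, never a formula of order n. *)
Fixpoint x_smooth (n : nat) (f : R -> R -> R) : Prop :=
  jointly_continuous f /\
  match n with
  | O => True
  | S n' => has_Dx f /\ x_smooth n' (Dx f)
  end.

Lemma x_smooth_continuous (n : nat) (f : R -> R -> R) :
  x_smooth n f -> jointly_continuous f.
Proof. destruct n; simpl; tauto. Qed.

Lemma x_smooth_has_Dx (n : nat) (f : R -> R -> R) : x_smooth (S n) f -> has_Dx f.
Proof. simpl; tauto. Qed.

Lemma x_smooth_Dx (n : nat) (f : R -> R -> R) : x_smooth (S n) f -> x_smooth n (Dx f).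
Proof. simpl; tauto. Qed.

Lemma x_smooth_ext (n : nat) (f g : R -> R -> R) :
  (forall x t, 0 < t -> f x t = g x t) -> x_smooth n f -> x_smooth n g.
Proof.
  revert f g; induction n as [|n IH]; intros f g h hf.
  - split; [|easy]. now apply (jointly_continuous_ext f), x_smooth_continuous with 0%nat.
  - split; [now apply (jointly_continuous_ext f), x_smooth_continuous with (S n)|].
    destruct hf as [_ [hd hf]]; split.
    + intros x t ht. apply ex_derive_ext with (fun x' => f x' t); auto.
    + apply IH with (Dx f); [|easy].
      intros x t ht; apply Derive_ext; auto.
Qed.

(** This lets the derivative be named by an explicit formula, which has to agree with [Dx f] at
    positive times only. *)
Lemma x_smooth_of_is_derive (n : nat) (f g : R -> R -> R) :
  jointly_continuous f ->
  (forall x t, 0 < t -> is_derive (fun x' => f x' t) x (g x t)) ->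
  x_smooth n g -> x_smooth (S n) f.
Proof.
  intros hc hd hg; split; [easy|split].
  - intros x t ht; eexists; apply hd, ht.
  - apply x_smooth_ext with g; [|easy].
    intros x t ht; symmetry; apply is_derive_unique, hd, ht.
Qed.

Lemma x_smooth_S (n : nat) (f : R -> R -> R) : x_smooth (S n) f -> x_smooth n f.
Proof.
  revert f; induction n as [|n IH]; intros f [hc [hd hf]]; split; auto.
Qed.

Lemma x_smooth_le (n n' : nat) (f : R -> R -> R) :
  (n <= n')%nat -> x_smooth n' f -> x_smooth n f.
Proof. induction 1; auto using x_smooth_S. Qed.

Lemma x_smooth_plus (n : nat) (f g : R -> R -> R) :
  x_smooth n f -> x_smooth n g -> x_smooth n (fun x t => f x t + g x t).
Proof.
  revert f g; induction n as [|n IH]; intros f g hf hg.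
  - split; [|easy]. apply jointly_continuous_plus; eapply x_smooth_continuous; eauto.
  - apply x_smooth_of_is_derive with (fun x t => Dx f x t + Dx g x t).
    + apply jointly_continuous_plus; eapply x_smooth_continuous; eauto.
    + intros x t ht; apply (is_derive_plus (V := R_NormedModule));
        apply has_Dx_is_derive; auto; eapply x_smooth_has_Dx; eauto.
    + apply IH; now apply x_smooth_Dx.
Qed.

Lemma x_smooth_mult (n : nat) (f g : R -> R -> R) :
  x_smooth n f -> x_smooth n g -> x_smooth n (fun x t => f x t * g x t).
Proof.
  revert f g; induction n as [|n IH]; intros f g hf hg.
  - split; [|easy]. apply jointly_continuous_mult; eapply x_smooth_continuous; eauto.
  - apply x_smooth_of_is_derive with (fun x t => Dx f x t * g x t + f x t * Dx g x t).
    + apply jointly_continuous_mult; eapply x_smooth_continuous; eauto.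
    + intros x t ht; apply (is_derive_mult (fun x' => f x' t) (fun x' => g x' t)).
      * apply has_Dx_is_derive; auto; eapply x_smooth_has_Dx; eauto.
      * apply has_Dx_is_derive; auto; eapply x_smooth_has_Dx; eauto.
      * intros; apply Rmult_comm.
    + apply x_smooth_plus; apply IH; auto using x_smooth_Dx, x_smooth_S.
Qed.

Lemma x_smooth_opp (n : nat) (f : R -> R -> R) :
  x_smooth n f -> x_smooth n (fun x t => - f x t).
Proof.
  revert f; induction n as [|n IH]; intros f hf.
  - split; [|easy]. apply jointly_continuous_opp; eapply x_smooth_continuous; eauto.
  - apply x_smooth_of_is_derive with (fun x t => - Dx f x t).
    + apply jointly_continuous_opp; eapply x_smooth_continuous; eauto.
    + intros x t ht; apply (is_derive_opp (V := R_NormedModule)), has_Dx_is_derive; auto.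
      eapply x_smooth_has_Dx; eauto.
    + apply IH; now apply x_smooth_Dx.
Qed.

(** * Smoothness of the reciprocal square root, and of u *)

Lemma one_plus_sq_pos (z : R) : 0 < 1 + z ^ 2.
Proof. pose proof (pow2_ge_0 z); lra. Qed.

Lemma sqrt_one_plus_sq_pos (z : R) : 0 < sqrt (1 + z ^ 2).
Proof. apply sqrt_lt_R0, one_plus_sq_pos. Qed.

Lemma sqrt_one_plus_sq_ge_1 (z : R) : 1 <= sqrt (1 + z ^ 2).
Proof.
  rewrite <- sqrt_1 at 1; apply sqrt_le_1_alt; pose proof (pow2_ge_0 z); lra.
Qed.

Lemma is_derive_sqrt_one_plus_sq (z : R) :
  is_derive (fun z => sqrt (1 + z ^ 2)) z (z / sqrt (1 + z ^ 2)).
Proof.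
  auto_derive; [apply one_plus_sq_pos|].
  pose proof (sqrt_one_plus_sq_pos z) as h.
  replace (z * (z * 1)) with (z ^ 2) by ring.
  simpl in *; field; lra.
Qed.

Lemma is_derive_inv_sqrt_one_plus_sq (z : R) :
  is_derive (fun z => / sqrt (1 + z ^ 2)) z (- z * (/ sqrt (1 + z ^ 2)) ^ 3).
Proof.
  pose proof (sqrt_one_plus_sq_pos z) as h.
  evar_last.
  - apply (is_derive_inv (fun z => sqrt (1 + z ^ 2))); [apply is_derive_sqrt_one_plus_sq|lra].
  - field; lra.
Qed.

(** The reciprocal w satisfies w_x = - v v_x w^3, a polynomial in v, v_x and w itself, so the
    induction closes on w. *)
Lemma x_smooth_inv_sqrt_one_plus_sq (n : nat) (v : R -> R -> R) :
  x_smooth n v -> x_smooth n (fun x t => / sqrt (1 + v x t ^ 2)).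
Proof.
  assert (hc : forall n v, x_smooth n v ->
    jointly_continuous (fun x t => / sqrt (1 + v x t ^ 2))).
  { intros n' v' hv; apply (jointly_continuous_comp (fun z => / sqrt (1 + z ^ 2))).
    - intros z; eexists; apply is_derive_inv_sqrt_one_plus_sq.
    - eapply x_smooth_continuous; eauto. }
  revert v; induction n as [|n IH]; intros v hv; [split; eauto|].
  set (w := fun x t => / sqrt (1 + v x t ^ 2)).
  apply x_smooth_of_is_derive with
    (fun x t => Dx v x t * (- v x t * (w x t * (w x t * w x t)))).
  - exact (hc _ _ hv).
  - intros x t ht.
    replace (w x t * (w x t * w x t)) with (w x t ^ 3) by ring.
    apply (is_derive_comp (fun z => / sqrt (1 + z ^ 2)) (fun x' => v x' t)).
    + apply is_derive_inv_sqrt_one_plus_sq.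
    + apply has_Dx_is_derive; auto; eapply x_smooth_has_Dx; eauto.
  - assert (hw : x_smooth n w) by (apply IH, x_smooth_S, hv).
    auto 10 using x_smooth_mult, x_smooth_opp, x_smooth_Dx, x_smooth_S.
Qed.

(** The order i is generalized because [Dx (Dxn i u)] is [Dxn (S i) u] by computation: each step
    moves one order from n to i. *)
Lemma smooth_x_smooth_Dxn (k : nat) (u : R -> R -> R) :
  smooth k u -> forall n i, (i + n = k + 2)%nat -> x_smooth n (Dxn i u).
Proof.
  intros hs n; induction n as [|n IH]; intros i hi.
  - split; [|easy]; apply (smooth_x k u hs); lia.
  - split; [apply (smooth_x k u hs); lia|split].
    + apply (smooth_x k u hs (S i)); lia.
    + apply (IH (S i)); lia.
Qed.

Lemma smooth_x_smooth (k : nat) (u : R -> R -> R) : smooth k u -> x_smooth (S (S k)) u.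
Proof. intros hs; apply (smooth_x_smooth_Dxn k u hs _ 0%nat); lia. Qed.

(** * Derivatives of the new space variable *)

(** The flux that goes with the conserved density [sqrt_m]; it turns out to be - y_t. *)
Definition flux (u : R -> R -> R) (x t : R) : R := cos (u x t) * sqrt_m u x t.

Lemma sqrt_m_pos (u : R -> R -> R) (x t : R) : 0 < sqrt_m u x t.
Proof. apply sqrt_one_plus_sq_pos. Qed.

Lemma sqrt_m_ge_1 (u : R -> R -> R) (x t : R) : 1 <= sqrt_m u x t.
Proof. apply sqrt_one_plus_sq_ge_1. Qed.

Lemma sqrt_m_sqr (u : R -> R -> R) (x t : R) :
  sqrt_m u x t * sqrt_m u x t = 1 + Dx u x t ^ 2.
Proof. apply sqrt_sqrt, Rlt_le, one_plus_sq_pos. Qed.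

Lemma x_smooth_sqrt_m (k : nat) (u : R -> R -> R) :
  smooth k u -> x_smooth (S k) (sqrt_m u).
Proof.
  intros hs; apply smooth_x_smooth in hs.
  apply x_smooth_Dx in hs.
  (* Writing sqrt m as m / sqrt m reduces the claim to the reciprocal square root. *)
  apply x_smooth_ext with
    (fun x t => (1 + Dx u x t * Dx u x t) * / sqrt (1 + Dx u x t ^ 2)).
  - intros x t _; fold (m u x t); fold (sqrt_m u x t).
    replace (1 + Dx u x t * Dx u x t) with (sqrt_m u x t * sqrt_m u x t)
      by (rewrite sqrt_m_sqr; ring).
    field; apply Rgt_not_eq, sqrt_m_pos.
  - apply x_smooth_mult; [|now apply x_smooth_inv_sqrt_one_plus_sq].
    apply (x_smooth_plus _ (fun _ _ => 1)); [|now apply x_smooth_mult].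
    clear; induction (S k) as [|n IH].
    + split; [|easy]. intros x t _; apply continuity_2d_pt_const.
    + apply x_smooth_of_is_derive with (fun _ _ => 0).
      * intros x t _; apply continuity_2d_pt_const.
      * intros x t _; apply (is_derive_const (V := R_NormedModule)).
      (* The zero function is written as 1 + (-1), so that the induction hypothesis about the
         constant 1 covers it. *)
      * apply x_smooth_ext with (fun x t => 1 + - 1); [intros; ring|].
        apply x_smooth_plus; [easy|now apply x_smooth_opp].
Qed.

Lemma is_derive_flux (k : nat) (u : R -> R -> R) (x t : R) :
  smooth k u -> 0 < t ->
  is_derive (fun x' => flux u x' t) x
    (- sin (u x t) * Dx u x t * sqrt_m u x t
     + cos (u x t) * (Dx u x t * Dx (Dx u) x t / sqrt_m u x t)).
Proof.
  intros hs ht; apply smooth_x_smooth in hs.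
  assert (h0 := has_Dx_is_derive u x t (x_smooth_has_Dx _ _ hs) ht).
  assert (h1 := has_Dx_is_derive (Dx u) x t
    (x_smooth_has_Dx _ _ (x_smooth_Dx _ _ hs)) ht).
  evar_last.
  - apply (is_derive_mult (fun x' => cos (u x' t)) (fun x' => sqrt_m u x' t)).
    + apply (is_derive_comp cos (fun x' => u x' t)); [apply is_derive_cos|exact h0].
    + apply (is_derive_comp (fun z => sqrt (1 + z ^ 2)) (fun x' => Dx u x' t));
        [apply is_derive_sqrt_one_plus_sq|exact h1].
    + intros; apply Rmult_comm.
  - cbv [plus mult scal]; simpl; unfold mult; simpl.
    fold (m u x t).
    change (sqrt (1 + Dx u x t * (Dx u x t * 1))) with (sqrt_m u x t).
    field; apply Rgt_not_eq, sqrt_m_pos.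
Qed.

Lemma Dx_flux (k : nat) (u : R -> R -> R) (x t : R) :
  smooth k u -> 0 < t ->
  Dx (flux u) x t =
    - sin (u x t) * Dx u x t * sqrt_m u x t
     + cos (u x t) * (Dx u x t * Dx (Dx u) x t / sqrt_m u x t).
Proof. intros hs ht; now apply is_derive_unique, (is_derive_flux k). Qed.

Lemma jointly_continuous_Dx_flux (k : nat) (u : R -> R -> R) :
  smooth k u -> jointly_continuous (Dx (flux u)).
Proof.
  intros hs.
  apply jointly_continuous_ext with
    (fun x t => - sin (u x t) * Dx u x t * sqrt_m u x t
     + cos (u x t) * (Dx u x t * Dx (Dx u) x t / sqrt_m u x t)).
  { intros x t ht; symmetry; now apply (Dx_flux k). }
  pose proof (smooth_x_smooth k u hs) as h0.
  pose proof (x_smooth_Dx _ _ h0) as h1.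
  pose proof (x_smooth_Dx _ _ h1) as h2.
  pose proof (x_smooth_inv_sqrt_one_plus_sq _ _ h1) as h3.
  pose proof (x_smooth_sqrt_m k u hs) as h4.
  apply x_smooth_continuous in h0, h1, h2, h3, h4.
  assert (hsin : jointly_continuous (fun x t => sin (u x t)))
    by (apply jointly_continuous_comp; [intros z; auto_derive; easy|easy]).
  assert (hcos : jointly_continuous (fun x t => cos (u x t)))
    by (apply jointly_continuous_comp; [intros z; auto_derive; easy|easy]).
  apply jointly_continuous_plus.
  - apply (jointly_continuous_mult (fun x t => - sin (u x t) * Dx u x t)); [|easy].
    apply (jointly_continuous_mult (fun x t => - sin (u x t))); [|easy].
    now apply jointly_continuous_opp.
  - apply jointly_continuous_mult; [easy|].
    apply (jointly_continuous_mult (fun x t => Dx u x t * Dx (Dx u) x t)); [|easy].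
    now apply jointly_continuous_mult.
Qed.

(** The equation prescribes [Dx (Dt u)], whereas differentiating m in time produces [Dt (Dx u)]. *)
Lemma smooth_mixed (k : nat) (u : R -> R -> R) (x t : R) :
  smooth k u -> 0 < t -> Dt (Dx u) x t = Dx (Dt u) x t.
Proof.
  intros hs ht; symmetry.
  destruct (smooth_tx k u hs) as [htx ctx].
  destruct (smooth_xt k u hs) as [hxt cxt].
  destruct (smooth_t k u hs) as [hdt _].
  assert (hdx := x_smooth_has_Dx _ _ (smooth_x_smooth k u hs)).
  apply (Schwarz u x t).
  - destruct (locally_2d_time_pos x t ht) as [d hd].
    exists d; intros a s ha hs'; assert (hs0 := hd a s ha hs').
    repeat split.
    + now apply hdx.
    + now apply hdt.
    + exact (htx a s hs0).
    + exact (hxt a s hs0).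
  - exact (ctx x t ht).
  - exact (cxt x t ht).
Qed.

(** Since (sin u)_xx = - sin u u_x^2 + cos u u_xx, the sine terms of the equation combine into sin u
    times m. *)
Lemma gSG_Dxt (k : nat) (u : R -> R -> R) (x t : R) :
  smooth k u -> gSG_equation u -> 0 < t ->
  Dx (Dt u) x t =
  sin (u x t) * (1 + Dx u x t ^ 2) - cos (u x t) * Dx (Dx u) x t.
Proof.
  intros hs hu ht; rewrite (hu x t ht).
  apply smooth_x_smooth in hs.
  assert (h0 := fun x => has_Dx_is_derive u x t (x_smooth_has_Dx _ _ hs) ht).
  assert (h1 := has_Dx_is_derive (Dx u) x t
    (x_smooth_has_Dx _ _ (x_smooth_Dx _ _ hs)) ht).
  assert (h2 : Dxn 2 (fun x' t' => sin (u x' t')) x t =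
    - sin (u x t) * Dx u x t ^ 2 + cos (u x t) * Dx (Dx u) x t).
  { change (Derive (fun x1 => Derive (fun x' => sin (u x' t)) x1) x =
      - sin (u x t) * Dx u x t ^ 2 + cos (u x t) * Dx (Dx u) x t).
    rewrite (Derive_ext _ (fun x1 => Dx u x1 t * cos (u x1 t))).
    2:{ intros x1; apply is_derive_unique.
        apply (is_derive_comp sin (fun x' => u x' t)); [apply is_derive_sin|apply h0]. }
    apply is_derive_unique; evar_last.
    - apply (is_derive_mult (fun x' => Dx u x' t) (fun x' => cos (u x' t))).
      + exact h1.
      + apply (is_derive_comp cos (fun x' => u x' t)); [apply is_derive_cos|apply h0].
      + intros; apply Rmult_comm.
    - cbv [plus mult scal]; simpl; unfold mult; simpl; ring. }
  rewrite h2; ring.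
Qed.

(** By the chain rule (sqrt m)_t = u_x u_xt / sqrt m; inserting the equation for u_xt gives u_x sin
    u sqrt m - cos u u_x u_xx / sqrt m, which is minus the x-derivative of the flux. *)
Lemma is_derive_t_sqrt_m (k : nat) (u : R -> R -> R) (x t : R) :
  smooth k u -> gSG_equation u -> 0 < t ->
  is_derive (fun t' => sqrt_m u x t') t (- Dx (flux u) x t).
Proof.
  intros hs hu ht.
  assert (h := has_Dt_is_derive (Dx u) x t (proj1 (smooth_xt k u hs)) ht).
  rewrite (smooth_mixed k u x t hs ht), (gSG_Dxt k u x t hs hu ht) in h.
  evar_last.
  - apply (is_derive_comp (fun z => sqrt (1 + z ^ 2)) (fun t' => Dx u x t'));
      [apply is_derive_sqrt_one_plus_sq|exact h].
  - rewrite (Dx_flux k u x t hs ht).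
    fold (m u x t); fold (sqrt_m u x t).
    cbv [plus mult scal]; simpl; unfold mult; simpl.
    replace (m u x t) with (sqrt_m u x t * sqrt_m u x t) by apply sqrt_m_sqr.
    field; apply Rgt_not_eq, sqrt_m_pos.
Qed.

Lemma is_derive_y_of_x (k : nat) (u : R -> R -> R) (x t : R) :
  smooth k u -> decaying u -> 0 < t ->
  is_derive (fun x' => y_of u x' t) x (sqrt_m u x t).
Proof.
  intros hs hd ht.
  assert (hc : forall x', continuous (fun x' => sqrt_m u x' t - 1) x').
  { intros x'; apply (continuous_minus (V := R_NormedModule));
      [|apply continuous_const].
    apply jointly_continuous_slice; [|easy].
    eapply x_smooth_continuous, x_smooth_sqrt_m; eauto. }
  assert (hI : is_derive (fun x' => y_integral u x' t) x (sqrt_m u x t - 1)).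
  { apply is_derive_ext with
      (fun x' => y_integral u x t + RInt (fun x' => sqrt_m u x' t - 1) x x').
    - intros x'; symmetry; apply is_RInt_gen_unique.
      apply (is_RInt_gen_Chasles (V := R_NormedModule) _ x).
      + apply (RInt_gen_correct (V := R_CompleteNormedModule)), (y_integral_converges u hd x t ht).
      + apply is_RInt_gen_at_point, (RInt_correct (V := R_CompleteNormedModule)).
        apply (ex_RInt_continuous (V := R_CompleteNormedModule)); intros; apply hc.
    - replace (sqrt_m u x t - 1) with (0 + (sqrt_m u x t - 1)) by ring.
      apply (is_derive_plus (V := R_NormedModule)).
      + apply (is_derive_const (V := R_NormedModule)).
      + apply (is_derive_RInt (V := R_NormedModule) (fun x' => sqrt_m u x' t - 1) _ x x).
        * apply filter_forall; intros x'.
          apply (RInt_correct (V := R_CompleteNormedModule)).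
          apply (ex_RInt_continuous (V := R_CompleteNormedModule)); intros; apply hc.
        * apply hc. }
  replace (sqrt_m u x t) with (1 - 0 + (sqrt_m u x t - 1)) by ring.
  apply (is_derive_plus (V := R_NormedModule) (fun x' => x' - t)); [|exact hI].
  apply (is_derive_minus (V := R_NormedModule)).
  - apply (is_derive_id (K := R_AbsRing)).
  - apply (is_derive_const (V := R_NormedModule)).
Qed.

(** Periodicity settles natural multiples, and evenness of cosine the negative ones. *)
Lemma cos_2PI_IZR (n : Z) : cos (2 * PI * IZR n) = 1.
Proof.
  assert (hN : forall j : nat, cos (2 * PI * INR j) = 1).
  { intros j; rewrite <- cos_0, <- (cos_period 0 j); f_equal; ring. }
  destruct (Z_le_dec 0 n) as [h|h].
  - rewrite <- (Z2Nat.id n h), <- INR_IZR_INZ; apply hN.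
  - rewrite <- cos_neg, <- (hN (Z.to_nat (- n))), INR_IZR_INZ, Z2Nat.id by lia.
    f_equal; rewrite opp_IZR; ring.
Qed.

(** The integer n in the limit of u may depend on t, but the cosine erases it; sqrt m tends to 1
    because u_x tends to 0. *)
Lemma flux_lim_m_infty (u : R -> R -> R) (t : R) :
  decaying u -> 0 < t -> filterlim (fun x => flux u x t) (Rbar_locally m_infty) (locally 1).
Proof.
  intros hd ht.
  destruct (decay_u u hd t ht) as [n hn].
  assert (hux := decay_ux u hd t ht).
  assert (h1 : 1 = cos (2 * PI * IZR n) * sqrt (1 + 0 ^ 2)).
  { replace (1 + 0 ^ 2) with 1 by ring; rewrite sqrt_1, Rmult_1_r.
    symmetry; apply cos_2PI_IZR. }
  rewrite h1.
  assert (hc : filterlim cos (locally (2 * PI * IZR n)) (locally (cos (2 * PI * IZR n)))).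
  { apply (ex_derive_continuous (V := R_NormedModule)); auto_derive; easy. }
  assert (hr : filterlim (fun z => sqrt (1 + z ^ 2)) (locally 0) (locally (sqrt (1 + 0 ^ 2)))).
  { apply (ex_derive_continuous (V := R_NormedModule) (fun z => sqrt (1 + z ^ 2))).
    eexists; apply is_derive_sqrt_one_plus_sq. }
  assert (hn' := filterlim_comp _ _ _ _ _ _ _ _ hn hc).
  assert (hux' := filterlim_comp _ _ _ _ _ _ _ _ hux hr).
  apply (filterlim_comp_2 _ _ _ hn' hux').
  apply (filterlim_mult (K := R_AbsRing)).
Qed.

(* The boundary term at -infinity is flux -> 1, which cancels the -t in y. *)
Lemma is_derive_y_of_t (k : nat) (u : R -> R -> R) (x t : R) :
  smooth k u -> decaying u -> gSG_equation u -> 0 < t ->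
  is_derive (fun t' => y_of u x t') t (- flux u x t).
Proof.
  intros hs hd hu ht.
  destruct (y_integral_dt u hd x t ht) as [l [hl hder]].
  (* The integrand (sqrt m)_t has the antiderivative - flux, so its integral is the value of - flux
     at x minus its limit -1 at minus infinity. *)
  assert (hl' : l = 1 - flux u x t).
  { rewrite <- (is_RInt_gen_unique _ _ hl).
    assert (hdf : forall x', ex_derive (fun x' => flux u x' t) x')
      by (intros x'; eexists; apply (is_derive_flux k); auto).
    assert (heq : forall x', Dt (sqrt_m u) x' t = Derive (fun x' => - flux u x' t) x').
    { intros x'; rewrite Derive_opp.
      apply is_derive_unique, (is_derive_t_sqrt_m k); auto. }
    apply is_RInt_gen_unique.
    replace (1 - flux u x t) with (- flux u x t - - 1) by ring.
    apply is_RInt_gen_ext with (Derive (fun x' => - flux u x' t)).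
    { apply filter_forall; intros ab x' _; symmetry; apply heq. }
    apply is_RInt_gen_Derive.
    - apply filter_forall; intros ab x' _.
      apply (ex_derive_opp (V := R_NormedModule)), hdf.
    - apply filter_forall; intros ab x' _.
      apply continuous_ext with (fun x' => - Dx (flux u) x' t).
      { intros z; rewrite Derive_opp; reflexivity. }
      apply (continuous_opp (V := R_NormedModule)).
      apply jointly_continuous_slice; [now apply (jointly_continuous_Dx_flux k)|easy].
    - apply filterlim_comp with (locally 1).
      + now apply flux_lim_m_infty.
      + apply (filterlim_opp (V := R_NormedModule)).
    (* At the upper endpoint the filter is the point x itself, so the limit is the value there. *)
    - intros P hP; unfold filtermap, at_point; now apply locally_singleton. }
  rewrite hl' in hder.
  replace (- flux u x t) with (0 - 1 + (1 - flux u x t)) by ring.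
  apply (is_derive_plus (V := R_NormedModule) (fun t' => x - t')); [|exact hder].
  apply (is_derive_minus (V := R_NormedModule)).
  - apply (is_derive_const (V := R_NormedModule)).
  - apply (is_derive_id (K := R_AbsRing)).
Qed.

(** * The inverse change of variables *)

Lemma y_of_MVT (k : nat) (u : R -> R -> R) (a b t : R) :
  smooth k u -> decaying u -> 0 < t ->
  exists c, Rmin a b <= c <= Rmax a b /\
    y_of u b t - y_of u a t = sqrt_m u c t * (b - a).
Proof.
  intros hs hd ht.
  apply (MVT_gen (fun x => y_of u x t) a b (fun x => sqrt_m u x t)).
  - intros x _; now apply (is_derive_y_of_x k).
  - intros x _; apply continuity_pt_filterlim.
    apply (ex_derive_continuous (V := R_NormedModule) (fun x => y_of u x t)).
    eexists; now apply (is_derive_y_of_x k).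
Qed.

(** The slope sqrt m is at least 1. Hence at each fixed time the inverse map is 1-Lipschitz. *)
Lemma y_of_expanding (k : nat) (u : R -> R -> R) (a b t : R) :
  smooth k u -> decaying u -> 0 < t ->
  Rabs (b - a) <= Rabs (y_of u b t - y_of u a t).
Proof.
  intros hs hd ht; destruct (y_of_MVT k u a b t hs hd ht) as [c [_ hc]].
  pose proof (sqrt_m_ge_1 u c t) as h1; pose proof (Rabs_pos (b - a)).
  rewrite hc, Rabs_mult, (Rabs_pos_eq (sqrt_m u c t)) by lra; nra.
Qed.

Lemma y_of_surjective (k : nat) (u : R -> R -> R) (y t : R) :
  smooth k u -> decaying u -> 0 < t -> exists x, y_of u x t = y.
Proof.
  intros hs hd ht.
  (* With slope at least 1, moving by r away from 0 moves [y_of] by at least r, so the values at - r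
     and r enclose y. *)
  set (r := Rabs (y - y_of u 0 t)).
  assert (hr : 0 <= r) by apply Rabs_pos.
  assert (hy : - r <= y - y_of u 0 t <= r) by (apply Rabs_le_between, Rle_refl).
  assert (hup : y_of u 0 t + r <= y_of u r t).
  { destruct (y_of_MVT k u 0 r t hs hd ht) as [c [_ hc]].
    pose proof (sqrt_m_ge_1 u c t); nra. }
  assert (hlo : y_of u (- r) t <= y_of u 0 t - r).
  { destruct (y_of_MVT k u (- r) 0 t hs hd ht) as [c [_ hc]].
    pose proof (sqrt_m_ge_1 u c t); nra. }
  destruct (IVT_gen (fun x => y_of u x t) (- r) r y) as [x [_ hx]].
  - intros x; apply continuity_pt_filterlim.
    apply (ex_derive_continuous (V := R_NormedModule) (fun x => y_of u x t)).
    eexists; now apply (is_derive_y_of_x k).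
  - rewrite Rmin_left, Rmax_right by lra; lra.
  - now exists x.
Qed.

(** The preimage is chosen by [epsilon]; its defining property is established for positive times
    only. *)
Definition x_of (u : R -> R -> R) (y t : R) : R :=
  epsilon (inhabits 0) (fun x => y_of u x t = y).

Lemma y_of_x_of (k : nat) (u : R -> R -> R) (y t : R) :
  smooth k u -> decaying u -> 0 < t -> y_of u (x_of u y t) t = y.
Proof.
  intros hs hd ht; unfold x_of; apply epsilon_spec; now apply (y_of_surjective k).
Qed.

(** With x the preimage of y at time t, expansion at time s bounds the displacement of [x_of] by |y'
    - y_of u x s|. This is at most |y' - y| plus the change of [y_of u x] from t to s, so continuity
    in time at the fixed x suffices. *)
Lemma jointly_continuous_x_of (k : nat) (u : R -> R -> R) :
  smooth k u -> decaying u -> gSG_equation u -> jointly_continuous (x_of u).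
Proof.
  intros hs hd hu y t ht eps.
  set (x := x_of u y t).
  assert (hx : y_of u x t = y) by now apply (y_of_x_of k).
  assert (hc : continuity_pt (fun s => y_of u x s) t).
  { apply continuity_pt_filterlim.
    apply (ex_derive_continuous (V := R_NormedModule) (fun s => y_of u x s)).
    eexists; now apply (is_derive_y_of_t k). }
  apply continuity_pt_locally with (eps := pos_div_2 eps) in hc.
  destruct hc as [d1 h1], (locally_time_pos t ht) as [d2 h2].
  assert (hdp : 0 < Rmin (eps / 2) (Rmin d1 d2)).
  { pose proof (cond_pos eps); pose proof (cond_pos d1); pose proof (cond_pos d2).
    repeat apply Rmin_glb_lt; lra. }
  exists (mkposreal _ hdp); simpl; intros y' s hy hs'.
  assert (hs0 : 0 < s).
  { apply h2; unfold ball; simpl; unfold AbsRing_ball, abs, minus, plus, opp; simpl.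
    eapply Rlt_le_trans; [exact hs'|].
    eapply Rle_trans; [apply Rmin_r|apply Rmin_r]. }
  assert (hs1 : Rabs (y_of u x s - y_of u x t) < eps / 2).
  { apply h1; unfold ball; simpl; unfold AbsRing_ball, abs, minus, plus, opp; simpl.
    eapply Rlt_le_trans; [exact hs'|].
    eapply Rle_trans; [apply Rmin_r|apply Rmin_l]. }
  assert (hy1 : Rabs (y' - y) < eps / 2)
    by (eapply Rlt_le_trans; [exact hy|apply Rmin_l]).
  eapply Rle_lt_trans; [apply (y_of_expanding k u _ _ s); auto|].
  rewrite (y_of_x_of k); auto.
  replace (y' - y_of u x s) with ((y' - y) - (y_of u x s - y_of u x t))
    by (rewrite hx; ring).
  unfold Rminus at 1; eapply Rle_lt_trans; [apply Rabs_triang|].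
  rewrite Rabs_Ropp; lra.
Qed.

(* No derivative of g is assumed: this is the implicit function theorem in
   quotient form, the ratio kappa being supplied by the mean value theorem. *)
Lemma is_derive_of_ratio (f g : R -> R) (s d kappa0 : R) :
  f s = 0 -> g s = 0 -> is_derive f s d ->
  (forall eps : posreal, locally s (fun s' =>
    exists kappa, Rabs (kappa - kappa0) < eps /\ g s' = f s' * kappa)) ->
  is_derive g s (d * kappa0).
Proof.
  intros hf0 hg0 hf hk; apply is_derive_Reals; apply is_derive_Reals in hf.
  intros eps heps.
  pose proof (Rabs_pos d) as hd; pose proof (Rabs_pos kappa0) as hk0.
  (* Each of the two error terms gets eps / 2. The 1 in the minimum below bounds |kappa| by |kappa0|
     + 1, and the added 1 keeps both denominators positive. *)
  assert (he1 : 0 < eps / (2 * (Rabs kappa0 + 1))) by (apply Rdiv_lt_0_compat; lra).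
  assert (he2 : 0 < Rmin 1 (eps / (2 * (Rabs d + 1)))).
  { apply Rmin_glb_lt; [lra|]. apply Rdiv_lt_0_compat; lra. }
  destruct (hf _ he1) as [d1 h1], (hk (mkposreal _ he2)) as [d2 h2].
  assert (hdp : 0 < Rmin d1 d2) by (apply Rmin_glb_lt; apply cond_pos).
  exists (mkposreal _ hdp); simpl; intros h hh0 hh.
  specialize (h1 h hh0 (Rlt_le_trans _ _ _ hh (Rmin_l _ _))).
  destruct (h2 (s + h)) as [kappa [hka hga]].
  { unfold ball; simpl; unfold AbsRing_ball, abs, minus, plus, opp; simpl.
    replace (s + h + - s) with h by ring.
    exact (Rlt_le_trans _ _ _ hh (Rmin_r _ _)). }
  simpl in hka; rewrite hga, hg0; rewrite hf0 in h1.
  set (F := (f (s + h) - 0) / h) in *.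
  replace ((f (s + h) * kappa - 0) / h - d * kappa0)
    with ((F - d) * kappa + d * (kappa - kappa0)) by (unfold F; field; easy).
  assert (hka1 : Rabs kappa <= Rabs kappa0 + 1).
  { replace kappa with (kappa0 + (kappa - kappa0)) by ring.
    eapply Rle_trans; [apply Rabs_triang|].
    pose proof (Rmin_l 1 (eps / (2 * (Rabs d + 1)))); lra. }
  assert (hka2 : Rabs (kappa - kappa0) < eps / (2 * (Rabs d + 1)))
    by (eapply Rlt_le_trans; [exact hka|apply Rmin_r]).
  eapply Rle_lt_trans; [apply Rabs_triang|]; rewrite !Rabs_mult.
  assert (hA : Rabs (F - d) * Rabs kappa <= eps / (2 * (Rabs kappa0 + 1)) * (Rabs kappa0 + 1))
    by (apply Rmult_le_compat; try apply Rabs_pos; lra).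
  assert (hB : Rabs d * Rabs (kappa - kappa0) < eps / 2).
  { apply Rle_lt_trans with (Rabs d * (eps / (2 * (Rabs d + 1)))).
    - apply Rmult_le_compat_l; lra.
    - replace (eps / 2) with ((Rabs d + 1) * (eps / (2 * (Rabs d + 1)))) by (field; lra).
      apply Rmult_lt_compat_r; [apply Rdiv_lt_0_compat; lra|lra]. }
  replace (eps / (2 * (Rabs kappa0 + 1)) * (Rabs kappa0 + 1)) with (eps / 2) in hA
    by (field; lra).
  lra.
Qed.

(** The mean value theorem at time s, between the old point and [x_of u y' s], gives kappa = 1 /
    sqrt m at an intermediate c. Continuity of [x_of] squeezes c to the old point. Freezing time or
    freezing y then yields the two partial derivatives. *)
Lemma x_of_increment (k : nat) (u : R -> R -> R) (y t : R) :
  smooth k u -> decaying u -> gSG_equation u -> 0 < t ->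
  forall eps : posreal, locally_2d (fun y' s =>
    exists kappa, Rabs (kappa - / sqrt_m u (x_of u y t) t) < eps /\
      x_of u y' s - x_of u y t = (y' - y_of u (x_of u y t) s) * kappa) y t.
Proof.
  intros hs hd hu ht eps; set (x := x_of u y t).
  assert (hw : jointly_continuous (fun x t => / sqrt_m u x t)).
  { intros a s hs0; apply continuity_2d_pt_inv; [|apply Rgt_not_eq, sqrt_m_pos].
    now apply (x_smooth_continuous _ _ (x_smooth_sqrt_m k u hs)). }
  destruct (hw x t ht eps) as [d1 h1].
  destruct (jointly_continuous_x_of k u hs hd hu y t ht d1) as [d2 h2].
  destruct (locally_2d_time_pos y t ht) as [d3 h3].
  assert (hdp : 0 < Rmin d1 (Rmin d2 d3))
    by (repeat apply Rmin_glb_lt; apply cond_pos).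
  exists (mkposreal _ hdp); simpl; intros y' s hy hs'.
  assert (hm := Rmin_l d1 (Rmin d2 d3)).
  assert (hm' := Rmin_r d1 (Rmin d2 d3)).
  assert (hm2 := Rmin_l d2 d3).
  assert (hm3 := Rmin_r d2 d3).
  assert (hs0 : 0 < s) by (apply (h3 y' s); lra).
  destruct (y_of_MVT k u x (x_of u y' s) s hs hd hs0) as [c [hc hmvt]].
  rewrite (y_of_x_of k) in hmvt by auto.
  exists (/ sqrt_m u c s); split.
  - apply h1; [|lra].
    assert (hX : Rabs (x_of u y' s - x) < d1) by (apply h2; lra).
    apply Rabs_def2 in hX; apply Rabs_def1;
    revert hc; unfold Rmin, Rmax; destruct (Rle_dec x (x_of u y' s)); lra.
  - rewrite hmvt; field; apply Rgt_not_eq, sqrt_m_pos.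
Qed.

Lemma is_derive_x_of_y (k : nat) (u : R -> R -> R) (y t : R) :
  smooth k u -> decaying u -> gSG_equation u -> 0 < t ->
  is_derive (fun y' => x_of u y' t) y (/ sqrt_m u (x_of u y t) t).
Proof.
  intros hs hd hu ht; set (x := x_of u y t).
  assert (hx : y_of u x t = y) by now apply (y_of_x_of k).
  apply is_derive_ext with (fun y' => x + (x_of u y' t - x)); [intros; simpl; ring|].
  replace (/ sqrt_m u x t) with (0 + 1 * / sqrt_m u x t) by ring.
  apply (is_derive_plus (V := R_NormedModule)); [apply (is_derive_const (V := R_NormedModule))|].
  apply is_derive_of_ratio with (fun y' => y' - y).
  - ring.
  - unfold x; ring.
  - auto_derive; [easy|ring].
  - intros eps; destruct (x_of_increment k u y t hs hd hu ht eps) as [d h].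
    exists d; intros y' hy'; rewrite <- hx; apply (h y' t); [exact hy'|].
    rewrite Rminus_diag, Rabs_R0; apply cond_pos.
Qed.

Lemma is_derive_x_of_t (k : nat) (u : R -> R -> R) (y t : R) :
  smooth k u -> decaying u -> gSG_equation u -> 0 < t ->
  is_derive (fun s => x_of u y s) t (cos (u (x_of u y t) t)).
Proof.
  intros hs hd hu ht; set (x := x_of u y t).
  assert (hx : y_of u x t = y) by now apply (y_of_x_of k).
  apply is_derive_ext with (fun s => x + (x_of u y s - x)); [intros; simpl; ring|].
  replace (cos (u x t)) with (0 + (0 - - flux u x t) * / sqrt_m u x t)
    by (unfold flux; field; apply Rgt_not_eq, sqrt_m_pos).
  apply (is_derive_plus (V := R_NormedModule)); [apply (is_derive_const (V := R_NormedModule))|].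
  apply is_derive_of_ratio with (fun s => y - y_of u x s).
  - rewrite hx; ring.
  - unfold x; ring.
  - apply (is_derive_minus (V := R_NormedModule) (fun _ => y)).
    + apply (is_derive_const (V := R_NormedModule)).
    + now apply (is_derive_y_of_t k).
  - intros eps; destruct (x_of_increment k u y t hs hd hu ht eps) as [d h].
    exists d; intros s hs'; apply (h y s); [|exact hs'].
    rewrite Rminus_diag, Rabs_R0; apply cond_pos.
Qed.

Definition in_ytau (u f : R -> R -> R) (y tau : R) : R := f (x_of u y tau) tau.

Lemma jointly_continuous_in_ytau (k : nat) (u f : R -> R -> R) :
  smooth k u -> decaying u -> gSG_equation u ->
  jointly_continuous f -> jointly_continuous (in_ytau u f).
Proof.
  intros hs hd hu hf y t ht; apply continuity_2d_pt_filterlim.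
  apply (continuous_comp_2 (fun z : R * R => x_of u (fst z) (snd z)) (fun z => snd z) f).
  - apply jointly_continuous_continuous; [now apply (jointly_continuous_x_of k)|easy].
  - apply continuous_snd.
  - now apply jointly_continuous_continuous.
Qed.

Lemma is_derive_in_ytau_y (k : nat) (u f : R -> R -> R) (y t : R) :
  smooth k u -> decaying u -> gSG_equation u -> has_Dx f -> 0 < t ->
  is_derive (fun y' => in_ytau u f y' t) y
    (in_ytau u (fun x s => Dx f x s * / sqrt_m u x s) y t).
Proof.
  intros hs hd hu hf ht; unfold in_ytau; rewrite Rmult_comm.
  apply (is_derive_comp (fun x => f x t) (fun y' => x_of u y' t)).
  - now apply has_Dx_is_derive.
  - now apply (is_derive_x_of_y k).
Qed.

Lemma is_derive_in_ytau_t (k : nat) (u f : R -> R -> R) (y t : R) :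
  smooth k u -> decaying u -> gSG_equation u ->
  has_Dx f -> jointly_continuous (Dx f) -> has_Dt f -> 0 < t ->
  is_derive (fun s => in_ytau u f y s) t
    (in_ytau u (fun x s => Dx f x s * cos (u x s) + Dt f x s) y t).
Proof.
  intros hs hd hu hx hc hft ht; unfold in_ytau.
  apply (is_derive_along_graph f (fun s => x_of u y s)); auto.
  now apply (is_derive_x_of_t k).
Qed.

(** * The sine-Gordon solution *)

(** The ratio is sin (atan z), and atan takes values in the interval where asin inverts sin. The
    arctangent form is easier to differentiate. *)
Lemma asin_ratio_atan (z : R) : asin (z / sqrt (1 + z ^ 2)) = atan z.
Proof.
  replace (z ^ 2) with (Rsqr z) by (unfold Rsqr; ring).
  rewrite <- sin_atan; apply asin_sin.
  pose proof (atan_bound z); lra.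
Qed.

Definition profile (u : R -> R -> R) (x t : R) : R := - u x t - atan (Dx u x t).

Lemma is_derive_opp_sub_atan (a b : R -> R) (s da db : R) :
  is_derive a s da -> is_derive b s db ->
  is_derive (fun s => - a s - atan (b s)) s (- da - db * / (1 + b s ^ 2)).
Proof.
  intros ha hb.
  apply (is_derive_minus (V := R_NormedModule) (fun s => - a s)).
  - now apply (is_derive_opp (V := R_NormedModule) a).
  - apply (is_derive_comp atan b); [|easy].
    replace (b s ^ 2) with (Rsqr (b s)) by (unfold Rsqr; ring).
    apply is_derive_atan.
Qed.

Lemma is_derive_profile_x (k : nat) (u : R -> R -> R) (x t : R) :
  smooth k u -> 0 < t ->
  is_derive (fun x' => profile u x' t) x
    (- Dx u x t - Dx (Dx u) x t * / (1 + Dx u x t ^ 2)).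
Proof.
  intros hs ht; apply smooth_x_smooth in hs.
  apply (is_derive_opp_sub_atan (fun x' => u x' t) (fun x' => Dx u x' t));
    apply has_Dx_is_derive; auto.
  - eapply x_smooth_has_Dx; eauto.
  - eapply x_smooth_has_Dx, x_smooth_Dx; eauto.
Qed.

Lemma is_derive_profile_t (k : nat) (u : R -> R -> R) (x t : R) :
  smooth k u -> 0 < t ->
  is_derive (fun t' => profile u x t') t
    (- Dt u x t - Dt (Dx u) x t * / (1 + Dx u x t ^ 2)).
Proof.
  intros hs ht.
  apply (is_derive_opp_sub_atan (fun t' => u x t') (fun t' => Dx u x t'));
    apply has_Dt_is_derive; auto.
  - exact (proj1 (smooth_t k u hs)).
  - exact (proj1 (smooth_xt k u hs)).
Qed.

Lemma inv_sqrt_m_sqr (u : R -> R -> R) (x t : R) :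
  / (1 + Dx u x t ^ 2) = / sqrt_m u x t * / sqrt_m u x t.
Proof. rewrite <- sqrt_m_sqr, Rinv_mult; reflexivity. Qed.

Lemma x_smooth_inv_sqrt_m (k : nat) (u : R -> R -> R) :
  smooth k u -> x_smooth (S k) (fun x t => / sqrt_m u x t).
Proof.
  intros hs; apply x_smooth_inv_sqrt_one_plus_sq.
  apply x_smooth_Dx; now apply smooth_x_smooth.
Qed.

(** One order is lost relative to u because the profile contains u_x. *)
Lemma x_smooth_profile (k : nat) (u : R -> R -> R) :
  smooth k u -> x_smooth (S k) (profile u).
Proof.
  intros hs.
  assert (h0 := smooth_x_smooth k u hs).
  assert (h1 := x_smooth_Dx _ _ h0).
  assert (h2 := x_smooth_Dx _ _ h1).
  assert (hw := x_smooth_S _ _ (x_smooth_inv_sqrt_m k u hs)).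
  apply x_smooth_of_is_derive with
    (fun x t => - Dx u x t + - (Dx (Dx u) x t * (/ sqrt_m u x t * / sqrt_m u x t))).
  - apply (jointly_continuous_plus (fun x t => - u x t)).
    + apply jointly_continuous_opp; eapply x_smooth_continuous; eauto.
    + apply jointly_continuous_opp, jointly_continuous_comp.
      * intros z; eexists; apply is_derive_atan.
      * eapply x_smooth_continuous; eauto.
  - intros x t ht; rewrite <- inv_sqrt_m_sqr; now apply (is_derive_profile_x k).
  - apply x_smooth_plus.
    + apply x_smooth_opp; now apply x_smooth_S.
    + apply x_smooth_opp, x_smooth_mult; [easy|now apply x_smooth_mult].
Qed.

Fixpoint profile_deriv (u : R -> R -> R) (j : nat) : R -> R -> R :=
  match j with
  | O => profile u
  | S j' => fun x t => Dx (profile_deriv u j') x t * / sqrt_m u x t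
  end.

(** Each application of f |-> f_x / sqrt m costs one order, which the constraint on j + n records;
    the factor 1 / sqrt m has all k + 1 orders. *)
Lemma x_smooth_profile_deriv (k : nat) (u : R -> R -> R) (j n : nat) :
  smooth k u -> (j + n = S k)%nat -> x_smooth n (profile_deriv u j).
Proof.
  intros hs; revert n; induction j as [|j IH]; intros n hn; simpl.
  - replace n with (S k) by lia; now apply x_smooth_profile.
  - apply x_smooth_mult.
    + apply x_smooth_Dx, IH; lia.
    + apply x_smooth_le with (S k); [lia|now apply x_smooth_inv_sqrt_m].
Qed.

Lemma corresponding_in_ytau (k : nat) (u Q : R -> R -> R) (y t : R) :
  smooth k u -> decaying u -> corresponding u Q -> 0 < t ->
  Q y t = in_ytau u (profile u) y t.
Proof.
  intros hs hd hQ ht.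
  rewrite <- (y_of_x_of k u y t hs hd ht) at 1.
  rewrite (hQ _ t ht), asin_ratio_atan; reflexivity.
Qed.

Lemma Dxn_corresponding (k : nat) (u Q : R -> R -> R) (j : nat) :
  smooth k u -> decaying u -> gSG_equation u -> corresponding u Q -> (j <= S k)%nat ->
  forall y t, 0 < t -> Dxn j Q y t = in_ytau u (profile_deriv u j) y t.
Proof.
  intros hs hd hu hQ; induction j as [|j IH]; intros hj y t ht.
  - now apply (corresponding_in_ytau k).
  - change (Derive (fun y' => Dxn j Q y' t) y = in_ytau u (profile_deriv u (S j)) y t).
    (* At the fixed positive time the induction hypothesis holds for every y', so both sides may be
       differentiated in y. *)
    rewrite (Derive_ext _ (fun y' => in_ytau u (profile_deriv u j) y' t))
      by (intros y'; apply IH; [lia|easy]).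
    apply is_derive_unique, (is_derive_in_ytau_y k); auto.
    apply (x_smooth_has_Dx (k - j)), (x_smooth_profile_deriv k); [easy|lia].
Qed.

(** The derivative is q_t + cos u q_x for the profile q. The equation gives u_xt / m = sin u - cos u
    u_xx / m, whose u_xx term cancels the one in cos u q_x. The result can therefore be
    differentiated in x once more even for k = 0. *)
Lemma is_derive_corresponding_t (k : nat) (u Q : R -> R -> R) (y t : R) :
  smooth k u -> decaying u -> gSG_equation u -> corresponding u Q -> 0 < t ->
  is_derive (fun s => Q y s) t
    (in_ytau u (fun x s => - Dt u x s - sin (u x s) - cos (u x s) * Dx u x s) y t).
Proof.
  intros hs hd hu hQ ht.
  apply is_derive_ext_loc with (fun s => in_ytau u (profile u) y s).
  (* The formula for Q holds at positive times only, hence the local form of extensionality. *)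
  { apply (filter_imp (fun s => 0 < s)); [|now apply locally_time_pos].
    intros s hs0; symmetry; now apply (corresponding_in_ytau k). }
  assert (hp := x_smooth_profile k u hs).
  evar_last.
  - apply (is_derive_in_ytau_t k); auto.
    + eapply x_smooth_has_Dx; eauto.
    + eapply x_smooth_continuous, x_smooth_Dx; eauto.
    + intros x s hs0; eexists; now apply (is_derive_profile_t k).
  - unfold in_ytau; set (x := x_of u y t).
    replace (Dx (profile u) x t) with (- Dx u x t - Dx (Dx u) x t * / (1 + Dx u x t ^ 2))
      by (symmetry; now apply is_derive_unique, (is_derive_profile_x k)).
    replace (Dt (profile u) x t) with (- Dt u x t - Dt (Dx u) x t * / (1 + Dx u x t ^ 2))
      by (symmetry; now apply is_derive_unique, (is_derive_profile_t k)).
    rewrite (smooth_mixed k), (gSG_Dxt k) by auto.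
    field; apply Rgt_not_eq, one_plus_sq_pos.
Qed.

Lemma corresponding_SG_solution (k : nat) (u Q : R -> R -> R) :
  smooth k u -> decaying u -> gSG_equation u -> corresponding u Q -> SG_solution k Q.
Proof.
  intros hs hd hu hQ.
  assert (h0 := smooth_x_smooth k u hs).
  assert (h1 := x_smooth_Dx _ _ h0).
  set (r := fun x s => - Dt u x s - sin (u x s) - cos (u x s) * Dx u x s).
  assert (hr : forall y t, 0 < t -> Dt Q y t = in_ytau u r y t)
    by (intros; now apply is_derive_unique, (is_derive_corresponding_t k)).
  (* Inserting the equation for u_tx, the u_xx terms cancel, and so do those in sin u u_x^2. *)
  assert (hrx : forall x t, 0 < t ->
    is_derive (fun x' => r x' t) x (- sin (u x t) - cos (u x t) * Dx u x t)).
  { intros x t ht.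
    assert (d0 := has_Dx_is_derive u x t (x_smooth_has_Dx _ _ h0) ht).
    assert (d1 := has_Dx_is_derive (Dx u) x t (x_smooth_has_Dx _ _ h1) ht).
    assert (d2 := has_Dx_is_derive (Dt u) x t (proj1 (smooth_tx k u hs)) ht).
    rewrite (gSG_Dxt k) in d2 by auto.
    evar_last.
    - apply (is_derive_minus (V := R_NormedModule)
        (fun x' => - Dt u x' t - sin (u x' t)) (fun x' => cos (u x' t) * Dx u x' t)).
      + apply (is_derive_minus (V := R_NormedModule) (fun x' => - Dt u x' t)).
        * apply (is_derive_opp (V := R_NormedModule)); exact d2.
        * apply (is_derive_comp sin (fun x' => u x' t)); [apply is_derive_sin|exact d0].
      + apply (is_derive_mult (fun x' => cos (u x' t)) (fun x' => Dx u x' t)).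
        * apply (is_derive_comp cos (fun x' => u x' t)); [apply is_derive_cos|exact d0].
        * exact d1.
        * intros; apply Rmult_comm.
    - cbv [minus plus opp mult scal]; simpl; unfold mult; simpl; ring. }
  assert (hQtx : forall y t, 0 < t -> is_derive (fun y' => Dt Q y' t) y
    (in_ytau u (fun x s => Dx r x s * / sqrt_m u x s) y t)).
  { intros y t ht; apply is_derive_ext with (fun y' => in_ytau u r y' t).
    - intros y'; symmetry; now apply hr.
    - apply (is_derive_in_ytau_y k); auto.
      intros x s hs0; eexists; now apply hrx. }
  split.
  - intros j hj.
    assert (hsm : x_smooth (S k - j) (profile_deriv u j))
      by (apply (x_smooth_profile_deriv k); [easy|lia]).
    split.
    (* Order 0 asks for nothing; order j + 1 asks that the j-th derivative be differentiable, which
       uses one of the k + 1 - j orders left. *)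
    + destruct j as [|j]; [easy|].
      intros y t ht; change (ex_derive (fun y' => Dxn j Q y' t) y).
      apply ex_derive_ext with (fun y' => in_ytau u (profile_deriv u j) y' t).
      { intros y'; symmetry; apply (Dxn_corresponding k); auto; lia. }
      eexists; apply (is_derive_in_ytau_y k); auto.
      apply (x_smooth_has_Dx (k - j)), (x_smooth_profile_deriv k); [easy|lia].
    + apply jointly_continuous_ext with (in_ytau u (profile_deriv u j)).
      { intros y t ht; symmetry; now apply (Dxn_corresponding k). }
      apply (jointly_continuous_in_ytau k); auto.
      eapply x_smooth_continuous; eauto.
  - split.
    + intros y t ht; eexists; apply (is_derive_corresponding_t k u Q y t); auto.
    + apply jointly_continuous_ext with (in_ytau u r).
      { intros y t ht; symmetry; now apply hr. }
      apply (jointly_continuous_in_ytau k); auto.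
      apply x_smooth_continuous in h0, h1.
      apply (jointly_continuous_plus (fun x s => - Dt u x s + - sin (u x s))
        (fun x s => - (cos (u x s) * Dx u x s))).
      * apply jointly_continuous_plus.
        -- apply jointly_continuous_opp; exact (proj2 (smooth_t k u hs)).
        -- apply jointly_continuous_opp, jointly_continuous_comp; [|easy].
           intros z; auto_derive; easy.
      * apply jointly_continuous_opp, jointly_continuous_mult; [|easy].
        apply jointly_continuous_comp; [|easy]. intros z; auto_derive; easy.
  - intros y t ht; eexists; now apply hQtx.
  - intros y t ht.
    rewrite (corresponding_in_ytau k u Q) by auto.
    transitivity (in_ytau u (fun x s => Dx r x s * / sqrt_m u x s) y t).
    { now apply is_derive_unique, hQtx. }
    unfold in_ytau; set (x := x_of u y t).
    replace (Dx r x t) with (- sin (u x t) - cos (u x t) * Dx u x t)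
      by (symmetry; now apply is_derive_unique, hrx).
    (* As cos (atan u_x) = 1 / sqrt m and sin (atan u_x) = u_x / sqrt m, the addition formula turns
       sin Q into (- sin u - cos u u_x) / sqrt m. *)
    unfold profile; rewrite sin_minus, sin_neg, cos_neg, sin_atan, cos_atan.
    replace (Rsqr (Dx u x t)) with (Dx u x t ^ 2) by (unfold Rsqr; ring).
    fold (m u x t); fold (sqrt_m u x t).
    field; apply Rgt_not_eq, sqrt_m_pos.
Qed.

(** * Transfer of the conservation law to the original variables *)

Theorem mainTheorem4 (k : nat) (A B : functional) (u Q : R -> R -> R)
  (hsmooth : smooth k u)
  (hdecay : decaying u)
  (hu : gSG_equation u)
  (hQ : corresponding u Q)
  (hAB : SG_conservation_law k A B) :
  let A_xt := in_xt u (eval_functional k A Q) in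
  let B_xt := in_xt u (eval_functional k B Q) in
  conserved
    (fun x t => sqrt (m u x t) * A_xt x t)
    (fun x t => B_xt x t - cos (u x t) * sqrt (m u x t) * A_xt x t).
Proof.
  destruct (hAB Q (corresponding_SG_solution k u Q hsmooth hdecay hu hQ))
    as [[hAt _] [[hAx hAxc] [_ [hBx hcons]]]].
  set (a := eval_functional k A Q) in *; set (b := eval_functional k B Q) in *.
  intros A_xt B_xt.
  (* At fixed x the point [y_of u x s] moves with velocity - flux, so A contributes a y-derivative
     besides its tau-derivative. *)
  assert (hrho : forall x t, 0 < t ->
    is_derive (fun s => sqrt_m u x s * A_xt x s) t
      (- Dx (flux u) x t * A_xt x t
       + sqrt_m u x t * (Dx a (y_of u x t) t * - flux u x t + Dt a (y_of u x t) t))).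
  { intros x t ht.
    apply (is_derive_mult (fun s => sqrt_m u x s) (fun s => A_xt x s)).
    - now apply (is_derive_t_sqrt_m k).
    - apply (is_derive_along_graph a (fun s => y_of u x s)); auto.
      now apply (is_derive_y_of_t k).
    - intros; apply Rmult_comm. }
  assert (hJ : forall x t, 0 < t ->
    is_derive (fun x' => B_xt x' t - flux u x' t * A_xt x' t) x
      (sqrt_m u x t * Dx b (y_of u x t) t
       - (Dx (flux u) x t * A_xt x t
          + flux u x t * (sqrt_m u x t * Dx a (y_of u x t) t)))).
  { intros x t ht.
    assert (hy := is_derive_y_of_x k u x t hsmooth hdecay ht).
    apply (is_derive_minus (V := R_NormedModule) (fun x' => B_xt x' t)).
    - apply (is_derive_comp (fun y => b y t) (fun x' => y_of u x' t)); [|easy].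
      now apply has_Dx_is_derive.
    - apply (is_derive_mult (fun x' => flux u x' t) (fun x' => A_xt x' t)).
      + apply has_Dx_is_derive; [|easy].
        intros x' s hs; eexists; now apply (is_derive_flux k).
      + apply (is_derive_comp (fun y => a y t) (fun x' => y_of u x' t)); [|easy].
        now apply has_Dx_is_derive.
      + intros; apply Rmult_comm. }
  split; [|split].
  - intros x t ht; eexists; now apply hrho.
  - intros x t ht; eexists; now apply hJ.
  - intros x t ht.
    etransitivity; [apply is_derive_unique, hrho, ht|].
    etransitivity; [|symmetry; apply is_derive_unique, hJ, ht].
    (* The terms in the x-derivative of the flux and in A_y agree on both sides, since y_t = - flux
       and y_x = sqrt m; what is left is sqrt m A_tau = sqrt m B_y. *)
    rewrite hcons by easy; ring.
Qed.
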